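(* Let $m$ and $p$ be integers with $2\le p\le m$. Then $s_{\mathbb R}(m,p)=1$ if and only if $m\ge 3p-2$; in other words, $s_{\mathbb R}(m,p)\ge 2$ if and only if $m\le 3(p-1)$.
   Context: Let $D^1=[-1,1]\subset\mathbb R$ and $S^0=\{\pm1\}$, a group under multiplication. The 2-torus $(S^0)^m$ acts on $(D^1)^m$ by coordinatewise multiplication. For integers $0\le p\le m$, $m\ge 1$, let $X_{m,p}\subset (D^1)^m$ be the set of points $(x_1,\dots,x_m)\in (D^1)^m$ such that at least $p$ of the coordinates lie in $S^0$ (i.e. the union, over all choices of $m-p$ coordinate positions, of the products with $D^1$ in those positions and $S^0$ in the remaining $p$ positions). This is the real moment-angle complex of the $(m-p-1)$-skeleton of the $(m-1)$-simplex, and it is invariant under $(S^0)^m$. The invariant $s_{\mathbb R}(m,p)$ is the maximum integer $k$ for which there is a subgroup of $(S^0)^m$ isomorphic to $(\mathbb Z/2)^k$ that acts freely on $X_{m,p}$. *)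

(* Defs.v *)
From HB Require Import structures.
From mathcomp Require Import all_boot all_order all_algebra all_fingroup.
From mathcomp Require Import all_classical all_reals.

Set Implicit Arguments.
Unset Strict Implicit.
Unset Printing Implicit Defensive.

Import Order.TTheory GRing.Theory Num.Theory.
Local Open Scope ring_scope.

Definition S0 (R : realType) : Type := seq_sub [:: 1; -1 : R].

HB.instance Definition _ (R : realType) := SubType.on (S0 R).
HB.instance Definition _ (R : realType) := Finite.on (S0 R).

Section SphereGroup.
Variable R : realType.
Implicit Types a b c : S0 R.

Fact S0_one_subproof : (1 : R) \in [:: 1; -1 : R].
Proof. by rewrite inE eqxx. Qed.

Fact S0_mul_subproof a b : val a * val b \in [:: 1; -1 : R].
Proof.
case: a b => [a /= +] [b /= +]; rewrite !inE.
by move=> /orP[] /eqP-> /orP[] /eqP->; rewrite ?mulrNN ?mulr1 ?mul1r eqxx ?orbT.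
Qed.

Definition S0_one : S0 R := SeqSub S0_one_subproof.
Definition S0_mul a b : S0 R := SeqSub (S0_mul_subproof a b).
Definition S0_inv a : S0 R := a.

Fact S0_mulA : associative S0_mul.
Proof. by move=> a b c; apply/val_inj; rewrite /= mulrA. Qed.

Fact S0_mul1 : left_id S0_one S0_mul.
Proof. by move=> a; apply/val_inj; rewrite /= mul1r. Qed.

Fact S0_mulV : left_inverse S0_one S0_inv S0_mul.
Proof.
move=> a; apply/val_inj => /=; case: a => [a /= +]; rewrite !inE.
by move=> /orP[] /eqP->; rewrite ?mulrNN mulr1.
Qed.

HB.instance Definition _ := Finite_isGroup.Build (S0 R) S0_mulA S0_mul1 S0_mulV.

Lemma val_S0_mul a b : val (a * b)%g = val a * val b. Proof. by []. Qed.

Lemma val_S0_one : val (1%g : S0 R) = 1. Proof. by []. Qed.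

End SphereGroup.

(* (S^0)^m, with the pointwise group structure of gproduct.v on {dffun _}. *)
Definition torus2 (R : realType) (m : nat) : finGroupType :=
  {dffun forall i : 'I_m, S0 R}.

Section TorusAction.
Variables (R : realType) (m : nat).
Implicit Types (x : 'rV[R]_m) (g : torus2 R m).

Definition torus_scale x g : 'rV[R]_m := \row_i (val (g i) * x 0 i).

Fact torus_scale1 x : torus_scale x 1%g = x.
Proof. by apply/rowP => i; rewrite mxE oneg_ffun mul1r. Qed.

Fact torus_scaleM x : act_morph torus_scale x.
Proof.
by move=>  g h; apply/rowP => i; rewrite !mxE mulg_ffun val_S0_mul mulrCA mulrA.
Qed.

Definition torus_act : {action torus2 R m &-> 'rV[R]_m} :=
  TotalAction torus_scale1 torus_scaleM.

End TorusAction.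

Local Open Scope classical_set_scope.

(* The real moment-angle complex X_{m,p} of the (m-p-1)-skeleton of the
   (m-1)-simplex. *)
Definition momentangle (R : realType) (m p : nat) : set 'rV[R]_m :=
  [set x : 'rV[R]_m | (forall i, -1 <= x 0 i <= 1) /\
           (p <= #|[set i | (x 0 i \in [:: 1; -1])%R]%SET|)%N].

Arguments momentangle : clear implicits.

Lemma momentangle_invariant (R : realType) (m p : nat) (g : torus2 R m) x :
  momentangle R m p x -> momentangle R m p (torus_act R m x g).
Proof.
have gE i : val (g i) = 1 \/ val (g i) = -1.
  by case: (g i) => a /=; rewrite !inE => /orP[] /eqP->; [left|right].
move=> [xD xS]; split=> [i|].
  have := xD i; rewrite mxE => /andP[x1 x2].
  case: (gE i) => ->; first by rewrite mul1r x1.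
  by rewrite mulN1r lerN2 x2 lerNl x1.
apply: leq_trans xS _; apply: subset_leq_card; apply/fintype.subsetP => i.
rewrite !inE mxE; case: (gE i) => ->; rewrite ?mul1r ?mulN1r //.
by rewrite eqr_opp orbC eqr_oppLR.
Qed.

Definition acts_freely (R : realType) (m : nat)
    (H : {group torus2 R m}) (X : set 'rV[R]_m) : Prop :=
  forall g x, g \in H -> X x -> torus_act R m x g = x -> g = 1%g.

(* (Z/2)^k is rendered as the additive group of row vectors over 'Z_2. *)
Definition has_free_rank (R : realType) (m p k : nat) : Prop :=
  exists H : {group torus2 R m},
    H \isog [set: 'rV['Z_2]_k]%SET /\ acts_freely H (momentangle R m p).

Lemma has_free_rank0 R m p : has_free_rank R m p 0.
Proof.
exists 1%G; split; last by move=> g x /set1gP.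
apply: trivial_isog => //.
by apply/setP => v; rewrite !inE; apply/esym/eqP/rowP => -[].
Qed.

Lemma card_S0 (R : realType) : #|{: S0 R}| = 2%N.
Proof.
rewrite -[RHS]/(size [:: 1; -1 : R]); apply: card_seq_sub.
by rewrite /= inE andbT -subr_eq0 opprK -(natrD _ 1 1) pnatr_eq0.
Qed.

Lemma card_torus2 R m : #|torus2 R m| = (2 ^ m)%N.
Proof.
rewrite card_dep_ffun /= card_S0 -[X in (2 ^ X)%N](size_enum_ord m) /image_mem.
by elim: (enum 'I_m) => //= i s ->; rewrite expnS.
Qed.

Lemma has_free_rank_le R m p k : has_free_rank R m p k -> (k <= m)%N.
Proof.
move=> [H [/card_isog cH _]].
have := max_card H; rewrite cH cardsT card_mx card_torus2 mul1n card_ord.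
by rewrite leq_exp2l.
Qed.

Lemma real_free_rank_exists R m p : exists k, `[< has_free_rank R m p k >].
Proof. by exists 0%N; apply/asboolP/has_free_rank0. Qed.

Lemma real_free_rank_bound R m p k : `[< has_free_rank R m p k >] -> (k <= m)%N.
Proof. by move/asboolP/has_free_rank_le. Qed.

Definition sR (R : realType) (m p : nat) : nat :=
  ex_maxn (@real_free_rank_exists R m p) (@real_free_rank_bound R m p).

Lemma sRP R m p :
  has_free_rank R m p (sR R m p) /\
  forall k, has_free_rank R m p k -> (k <= sR R m p)%N.
Proof.
rewrite /sR; case: ex_maxnP => k /asboolP hk kmax; split=> // j hj.
exact/kmax/asboolP.
Qed.

(* Main.v *)
(* A sign vector g fixes a point of X_{m,p} iff at least p of its entries are 1:
   the entries -1 force zero coordinates, and the remaining coordinates may be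
   set to 1.  Freely acting subgroups are thus binary linear codes of length m
   whose nonzero words all have fewer than p zeros.  In dimension 1 the all-ones
   word works.  In dimension 2, every coordinate is a zero of at least one of
   a, b, a + b, which gives m <= 3(p - 1); conversely, columns (0,1), (1,0),
   (1,1) repeated cyclically distribute the zeros evenly. *)

Require Import Defs.
From mathcomp Require Import all_boot all_order all_algebra all_fingroup.
From mathcomp Require Import all_classical all_reals.
From mathcomp Require Import zify.

Set Implicit Arguments.
Unset Strict Implicit.
Unset Printing Implicit Defensive.

Import Order.TTheory GRing.Theory Num.Theory.
Local Open Scope ring_scope.

Lemma Z2_cases (a : 'Z_2) : a = 0 \/ a = 1.
Proof. by case: a => [[|[|n]]] // lt_n2; [left | right]; apply/val_inj. Qed.

Section Signs.
Variable R : realType.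
Implicit Types a b : S0 R.

Fact S0_opp1_subproof : (-1 : R) \in [:: 1; -1 : R].
Proof. by rewrite !inE eqxx orbT. Qed.

Definition S0_opp1 : S0 R := SeqSub S0_opp1_subproof.

Lemma S0_cases a : a = 1%g \/ a = S0_opp1.
Proof.
have := valP a; rewrite !inE => /orP[] /eqP a1; [left | right];
  exact/val_inj.
Qed.

Lemma S0_opp1_neq1 : S0_opp1 != 1%g.
Proof.
by rewrite -val_eqE /= -subr_eq0 -opprD oppr_eq0 -(natrD _ 1 1) pnatr_eq0.
Qed.

Lemma S0_opp1_sqr : (S0_opp1 * S0_opp1 = 1)%g.
Proof. by apply/val_inj; rewrite /= mulrNN mulr1. Qed.

(** A group of order 2 has a single nontrivial element, and that element squares to 1. *)
Lemma S0_mul_pigeonhole a b : [|| a == 1, b == 1 | a * b == 1]%g.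
Proof.
by case: (S0_cases a) => ->; case: (S0_cases b) => ->;
  rewrite ?eqxx ?S0_opp1_sqr ?eqxx ?orbT.
Qed.

(** The isomorphism from additive ['Z_2] to multiplicative [S0 R], which carries binary codewords to
    sign vectors. *)
Definition sign_of (u : 'Z_2) : S0 R := if u == 0 then 1%g else S0_opp1.

Lemma sign_of_eq1 u : (sign_of u == 1%g) = (u == 0).
Proof.
by rewrite /sign_of; case: (u == 0); rewrite ?eqxx // (negPf S0_opp1_neq1).
Qed.

Lemma sign_ofD u v : sign_of (u + v) = (sign_of u * sign_of v)%g.
Proof.
by case: (Z2_cases u) => ->; case: (Z2_cases v) => ->;
  rewrite /sign_of ?add0r ?addr0 ?eqxx /= ?mul1g ?mulg1 ?S0_opp1_sqr.
Qed.

End Signs.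

Section FreeSubgroups.
Variables (R : realType) (m p : nat).
Implicit Types (g : torus2 R m) (H : {group torus2 R m}).

Definition trivial_coords g : {set 'I_m} := [set i | g i == 1%g]%SET.

Lemma torus_fixed_pointP g :
  (exists2 x, momentangle R m p x & torus_act R m x g = x) <->
  (p <= #|trivial_coords g|)%N.
Proof.
split=> [[x [_ p_le] gx]|p_le].
  apply: leq_trans p_le _; apply/subset_leq_card/fintype.subsetP => i.
  rewrite !inE => xi; have /rowP/(_ i) := gx; rewrite mxE.
  case: (S0_cases (g i)) => [-> //|-> /eqP].
  (* A sign -1 that fixes the coordinate forces twice that coordinate to vanish, so it is 0 and not
     in [S0 R]. *)
  rewrite /= mulN1r eq_sym -subr_eq0 opprK -mulr2n mulrn_eq0 /= => /eqP xi0.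
  by move: xi; rewrite xi0 eq_sym oner_eq0 eq_sym oppr_eq0 oner_eq0.
exists (\row_i (g i == 1%g)%:R).
  split=> [i|].
    by rewrite mxE; case: (g i == _); rewrite ?lexx ?ler01 ?lerN10 ?andbT //=
      -subr_ge0 opprK addr_ge0 ?ler01.
  apply: leq_trans p_le _; apply/subset_leq_card/fintype.subsetP => i.
  by rewrite !inE mxE => ->; rewrite eqxx.
apply/rowP => i; rewrite !mxE.
by case: eqP => [->|_]; rewrite ?mulr0 ?mul1r.
Qed.

Lemma acts_freelyP H :
  acts_freely H (momentangle R m p) <->
  (forall g, g \in H -> g != 1%g -> (#|trivial_coords g| < p)%N).
Proof.
split=> [free g gH g1|few g x gH Xx gx].
  rewrite ltnNge; apply/negP => /torus_fixed_pointP[x Xx gx].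
  by move/eqP: g1; apply; exact: free gx.
apply/eqP/negPn/negP => /(few g gH); rewrite ltnNge => /negP; apply.
by apply/torus_fixed_pointP; exists x.
Qed.

Lemma card_trivial_coords_mul (a b : torus2 R m) :
  (m <= #|trivial_coords a| + #|trivial_coords b|
        + #|trivial_coords (a * b)%g|)%N.
Proof.
rewrite -[X in (X <= _)%N]card_ord -cardsT.
have sub : [set: 'I_m]%SET \subset trivial_coords a :|: trivial_coords b
                                   :|: trivial_coords (a * b)%g.
  by apply/fintype.subsetP => i _;
    rewrite !inE mulg_ffun -orbA S0_mul_pigeonhole.
apply: leq_trans (subset_leq_card sub) _.
by apply: leq_trans (leq_card_setU _ _) _; rewrite leq_add2r leq_card_setU.
Qed.

Lemma free_rank_ge2_bound k :
  has_free_rank R m p k -> (2 <= k)%N -> (m <= 3 * (p - 1))%N.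
Proof.
move=> [H [/card_isog cH /acts_freelyP few]] k_ge2.
have {cH} H_ge4 : (4 <= #|H|)%N.
  by rewrite cH cardsT card_mx mul1n card_ord -[4%N]/(2 ^ 2)%N leq_exp2l.
have /trivgPn[a aH a1] : H :!=: 1%g.
  by rewrite trivg_card1; case: #|H| H_ge4 => [|[]].
(* The set [[set 1%g; a]] has at most two elements, while [H] has at least four. *)
have /subsetPn[b bH] : ~~ (H \subset [set 1%g; a]).
  by apply: contraL H_ge4 => /subset_leq_card; rewrite cards2; lia.
rewrite !inE negb_or => /andP[b1 ba].
(* The pigeonhole is applied to [a^-1] and [b], because nontriviality of [a^-1 * b] says exactly
   that [b] differs from [a]. *)
have ab1 : (a^-1 * b)%g != 1%g by rewrite -eq_mulVg1 eq_sym.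
have aV1 : (a^-1)%g != 1%g by rewrite invg_eq1.
have lt_p3 x y z : (x < p -> y < p -> z < p -> x + y + z <= 3 * (p - 1))%N.
  by lia.
apply: leq_trans (card_trivial_coords_mul a^-1 b) (lt_p3 _ _ _ _ _ _).
- exact: few (groupVr aH) aV1.
- exact: few bH b1.
- exact: few (groupM (groupVr aH) bH) ab1.
Qed.

(** The rows of [G] generate a code, and the signs of its words form the desired subgroup. *)
Lemma code_has_free_rank k (G : 'M['Z_2]_(k, m)) : (p <= m)%N ->
  (forall v : 'rV_k, v != 0 ->
     (#|[set i | ((v *m G) 0 i == 0)%R]%SET| < p)%N) ->
  has_free_rank R m p k.
Proof.
move=> p_le_m few.
pose f (v : 'rV['Z_2]_k) : torus2 R m := [ffun i => sign_of R ((v *m G) 0 i)].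
have fM : {in [set: 'rV['Z_2]_k]%SET &, {morph f : u v / (u * v)%g}}.
  by move=> u v _ _; apply/ffunP => i;
    rewrite mulg_ffun !ffunE mulmxDl mxE sign_ofD.
have triv_f v : trivial_coords (f v) = [set i | (v *m G) 0 i == 0]%SET.
  by apply/setP => i; rewrite !inE ffunE sign_of_eq1.
have f_inj : ('injm (Morphism fM))%g.
  (* If [u] and [v] had the same image without being equal, the word of [u - v] would vanish at all
     [m >= p] coordinates, too many for a nonzero [u - v]. *)
  apply/injmP => u v _ _ /= fuv; apply/eqP; rewrite -subr_eq0.
  apply/negPn/negP => /few; rewrite ltnNge => /negP; apply.
  apply: leq_trans p_le_m _; rewrite -[X in (X <= _)%N]card_ord -cardsT.
  apply/subset_leq_card/fintype.subsetP => i _; rewrite inE -(sign_of_eq1 R).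
  rewrite mulmxBl !mxE; have /ffunP/(_ i) := fuv; rewrite !ffunE !mxE => uv.
  by rewrite sign_ofD uv -sign_ofD subrr sign_of_eq1.
exists (Morphism fM @* [set: 'rV['Z_2]_k])%G; split.
  by rewrite isog_sym; exact: (sub_isog (subxx _) f_inj).
apply/acts_freelyP => _ /morphimP[v _ _ ->] fv1.
rewrite triv_f; apply: few; apply: contraNneq fv1 => ->.
exact/eqP/(morph1 (Morphism fM)).
Qed.

Lemma has_free_rank1 : (0 < p <= m)%N -> has_free_rank R m p 1.
Proof.
move=> /andP[p_gt0 p_le_m].
apply: (code_has_free_rank (G := const_mx 1)) => // v v0.
rewrite (_ : [set i | _]%SET = finset.set0) ?cards0 //; apply/setP => i.
rewrite !inE mxE big_ord1 mxE mulr1; apply: contraNF v0 => /eqP v00.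
by apply/eqP/rowP => j; rewrite ord1 mxE.
Qed.

(** Division by 3 is injective on a residue class, and its quotients stay below [n]. *)
Lemma card_ord_mod3 (n c : nat) : (m <= 3 * n)%N ->
  (#|[set i : 'I_m | (i %% 3 == c)%N]%SET| <= n)%N.
Proof.
move=> m_le; rewrite -[X in (_ <= X)%N]card_ord.
have lt_div (i : 'I_m) : (i %/ 3 < n)%N by have := ltn_ord i; lia.
rewrite -(card_in_imset (f := fun i => Ordinal (lt_div i))) ?max_card //.
move=> i j; rewrite !inE => /eqP ic /eqP jc [ij].
by apply/val_inj; rewrite /= (divn_eq i 3) (divn_eq j 3) ic jc ij.
Qed.

Lemma has_free_rank2 : (p <= m)%N -> (0 < p)%N -> (m <= 3 * (p - 1))%N ->
  has_free_rank R m p 2.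
Proof.
move=> p_le_m p_gt0 m_le.
pose G : 'M['Z_2]_(2, m) := \matrix_(r, i) (i %% 3 != r)%N%:R.
apply: (code_has_free_rank (G := G)) => // v v0.
have vG i : (v *m G) 0 i =
    v 0 0 * (i %% 3 != 0)%N%:R + v 0 1 * (i %% 3 != 1)%N%:R.
  rewrite mxE big_ord_recl big_ord1 !mxE; congr (_ + v _ _ * _).
  exact/val_inj.
(* The zeros of each nonzero word lie in one residue class modulo 3, which has at most [p - 1]
   members. *)
suff [c sub_c] : exists c : nat, forall i, (v *m G) 0 i == 0 -> (i %% 3 == c)%N.
  have := card_ord_mod3 c m_le.
  have : ([set i | (v *m G) 0 i == 0]
            \subset [set i : 'I_m | (i %% 3 == c)%N])%SET.
    by apply/fintype.subsetP => i; rewrite !inE => /sub_c.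
  by move=> /subset_leq_card; lia.
(* The words of (0,1), (1,0) and (1,1) vanish on the classes 1, 0 and 2 respectively; the last
   because 1 + 1 = 0 in ['Z_2]. *)
have [v00|v00] := Z2_cases (v 0 0); have [v01|v01] := Z2_cases (v 0 1).
- case/eqP: v0; apply/rowP => j; rewrite mxE.
  by case: j => [[|[|n]]] // lt_n; [rewrite -[RHS]v00 | rewrite -[RHS]v01];
    congr (v _ _); apply/val_inj.
- exists 1%N => i; rewrite vG v00 v01.
  by have := ltn_pmod i (isT : 0 < 3)%N; case: (i %% 3)%N => [|[|[|]]].
- exists 0%N => i; rewrite vG v00 v01.
  by have := ltn_pmod i (isT : 0 < 3)%N; case: (i %% 3)%N => [|[|[|]]].
- exists 2%N => i; rewrite vG v00 v01.
  by have := ltn_pmod i (isT : 0 < 3)%N; case: (i %% 3)%N => [|[|[|]]].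
Qed.

End FreeSubgroups.

Theorem theorem3p1 (R : realType) (m p : nat)
    (hp : (2 <= p)%N) (hpm : (p <= m)%N) :
  (sR R m p = 1%N <-> (3 * p - 2 <= m)%N) /\
  ((2 <= sR R m p)%N <-> (m <= 3 * (p - 1))%N).
Proof.
have p_gt0 : (0 < p)%N by lia.
have [s_free s_max] := sRP R m p.
have s_ge1 : (1 <= sR R m p)%N by apply/s_max/has_free_rank1/andP.
have s_ge2 : (2 <= sR R m p)%N <-> (m <= 3 * (p - 1))%N.
  split=> [s_ge2|m_le]; first by apply: (free_rank_ge2_bound s_free).
  exact/s_max/has_free_rank2.
(* As the rank is at least 1, it equals 1 exactly when it is not at least 2, and [3 * p - 2] is the
   successor of [3 * (p - 1)]. *)
by split=> //; split; move: s_ge1 s_ge2; lia.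
Qed.
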